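(* Let $k\in\mathbb{N}$, and let $f_j:\mathbb{R}_+\to\mathbb{R}$ be strictly increasing for $j\in\{0,1,\dots,k\}$. Then the following conditions are equivalent. (a) For all $n\in\mathbb{N}$ and for all $(x_{1,1},\dots,x_{1,k}),\dots,(x_{n,1},\dots,x_{n,k})\in\mathbb{R}_+^k$, $$A^{[n]}_{f_0}\big(x_{1,1}\cdots x_{1,k},\dots,x_{n,1}\cdots x_{n,k}\big)\leq A^{[n]}_{f_1}(x_{1,1},\dots,x_{n,1})\cdots A^{[n]}_{f_k}(x_{1,k},\dots,x_{n,k}).$$ (b) For all $n\in\mathbb{N}$, for all $(x_{1,1},\dots,x_{1,k}),\dots,(x_{n,1},\dots,x_{n,k})\in\mathbb{R}_+^k$, and for all $(\lambda_1,\dots,\lambda_n)\in\Lambda_n$, $$\widetilde{A}^{[n]}_{f_0}\big(x_{1,1}\cdots x_{1,k},\dots,x_{n,1}\cdots x_{n,k};\lambda_1,\dots,\lambda_n\big)\leq \widetilde{A}^{[n]}_{f_1}(x_{1,1},\dots,x_{n,1};\lambda_1,\dots,\lambda_n)\cdots \widetilde{A}^{[n]}_{f_k}(x_{1,k},\dots,x_{n,k};\lambda_1,\dots,\lambda_n).$$ (c) For all $(x_1,\dots,x_k),(y_1,\dots,y_k)\in\mathbb{R}_+^k$, $$A^{[2]}_{f_0}\big(x_1\cdots x_k,\,y_1\cdots y_k\big)\leq A^{[2]}_{f_1}(x_1,y_1)\cdots A^{[2]}_{f_k}(x_k,y_k).$$ (d) The functions $f_0,f_1,\dots,f_k$ are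 continuous and the function $\Psi:f_1(\mathbb{R}_+)\times\dots\times f_k(\mathbb{R}_+)\to\mathbb{R}$ defined by $$\Psi(u_1,\dots,u_k):=f_0\big(f_1^{-1}(u_1)\cdots f_k^{-1}(u_k)\big)$$ is concave.
   Context: Conventions: $\mathbb{N}=\{1,2,\dots\}$; $\mathbb{R}_+=(0,\infty)$; ''increasing'' means nondecreasing (as opposed to ''strictly increasing''). $\operatorname{conv}(S)$ is the convex hull of $S\subseteq\mathbb{R}$. Weights: $\Lambda_n:=[0,\infty)^n\setminus\{(0,\dots,0)\}$. Generalized inverse: if $J\subseteq\mathbb{R}$ is a nonempty open interval and $f:J\to\mathbb{R}$ is strictly increasing (not necessarily continuous), then there is a unique increasing function $f^{(-1)}:\operatorname{conv}(f(J))\to J$ with $f^{(-1)}(f(x))=x$ for all $x\in J$; it is called the generalized inverse of $f$ (it is continuous and satisfies $f(f^{(-1)}(y))=y$ for $y\in f(J)$). Generalized quasi-arithmetic means: for such $f$ and $n\in\mathbb{N}$, $$A^{[n]}_{f}(x_1,\dots,x_n):=f^{(-1)}\Big(\frac{f(x_1)+\dots+f(x_n)}{n}\Big)\quad ((x_1,\dots,x_n)\in J^n),$$ $$\widetilde{A}^{[n]}_{f}(x_1,\dots,x_n;\lambda_1,\dots,\lambda_n):=f^{(-1)}\Big(\frac{\lambda_1f(x_1)+\dots+\lambda_nf(x_n)}{\lambda_1+\dots+\lambda_n}\Big)\quad ((x_1,\dots,x_n)\in J^n,\ (\lambda_1,\dots,\lambda_n)\in\Lambda_n).$$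
   Formalization: For k = 1 it is additionally assumed that at least one of f_0, f_1 is continuous; without this the claim fails, e.g. for f_0 = f_1 discontinuous, where (a), (b), (c) hold with equality but (d) fails. For k ≥ 2 nothing is added. *)

(* Defs.v *)
From HB Require Import structures.
From mathcomp Require Import all_boot all_order all_algebra.
From mathcomp Require Import all_classical all_reals all_analysis.
Set Implicit Arguments.
Unset Strict Implicit.
Unset Printing Implicit Defensive.
Import Order.TTheory GRing.Theory Num.Theory.
Import numFieldNormedType.Exports.
Local Open Scope classical_set_scope.
Local Open Scope ring_scope.
Local Open Scope convex_scope.

Definition Rpos (R : realType) : set R := `]0, +oo[%classic.
Arguments Rpos : clear implicits.

Definition strictly_increasing (R : realType) (J : set R) (f : R -> R) : Prop :=
  forall x y, J x -> J y -> x < y -> f x < f y.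

Definition conv_hull (R : realType) (A : set R) : set R :=
  smallest (@convex_set R R^o) A.

(* Functions are total on [R]: only the values of [f] on [J] and those of [g]
   on [conv_hull (f @` J)] matter. *)
Definition is_gen_inverse (R : realType) (J : set R) (f g : R -> R) : Prop :=
  [/\ forall y, conv_hull (f @` J) y -> J (g y),
      forall y z, conv_hull (f @` J) y -> conv_hull (f @` J) z ->
        y <= z -> g y <= g z
    & forall x, J x -> g (f x) = x].

(* The definite description is legitimate on [conv_hull (f @` J)]: see
   [is_gen_inverse_ex] and [is_gen_inverse_uniq]. *)
Definition gen_inverse (R : realType) (J : set R) (f : R -> R) : R -> R :=
  xget (fun=> 0) [set g | is_gen_inverse J f g].

Definition qamean (R : realType) (J : set R) (f : R -> R) (n : nat)
    (x : n.-tuple R) : R :=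
  gen_inverse J f ((\sum_(i < n) f (tnth x i)) / n%:R).

Definition wqamean (R : realType) (J : set R) (f : R -> R) (n : nat)
    (x : n.-tuple R) (l : 'I_n -> R) : R :=
  gen_inverse J f
    ((\sum_(i < n) l i * f (tnth x i)) / (\sum_(i < n) l i)).

Definition weights (R : realType) (n : nat) : set ('I_n -> R) :=
  [set l | (forall i, 0 <= l i) /\ (exists i, l i != 0)].
Arguments weights : clear implicits.

(* [convex_function] does not ask for the convexity of [D]; here it is automatic,
   as [D] will be a product of images of an interval under continuous maps. *)
Definition concave_function (R : realType) (E : lmodType R)
    (D : set (convex_lmodType E)) (F : E -> R) : Prop :=
  convex_function D (fun u => - F u).

(* Index [0] of ['I_k.+1] is f_0; the outer functions f_1, ..., f_k are
   [f (lift ord0 j)] for [j : 'I_k]. *)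
Definition Psi_dom (R : realType) (k : nat) (J : set R)
    (f : 'I_k.+1 -> R -> R) : set 'rV[R]_k :=
  [set u | forall j : 'I_k, (f (lift ord0 j) @` J) (u ord0 j)].

(* [pinv J h] is the inverse of [h], injective on [J], on the image [h @` J]. *)
Definition Psi (R : realType) (k : nat) (J : set R)
    (f : 'I_k.+1 -> R -> R) (u : 'rV[R]_k) : R :=
  f ord0 (\prod_(j < k) pinv J (f (lift ord0 j)) (u ord0 j)).

Section gen_inverse_wd.
Context (R : realType) (J : set R) (f : R -> R).
Hypotheses (Jitv : is_interval J) (fi : strictly_increasing J f).

Lemma conv_hull_le y : conv_hull (f @` J) y ->
  exists a b, [/\ J a, J b & f a <= y <= f b].
Proof.
pose C := [set z | exists a b, [/\ J a, J b & f a <= z <= f b]].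
apply: (_ : (smallest _ _ `<=` C)); apply: smallest_sub; last first.
  by move=> _ [x Jx <-]; exists x, x; rewrite lexx.
move=> z w t; rewrite !inE => -[a [b [Ja Jb /andP[az zb]]]].
move=> [c [d [Jc Jd /andP[cw wd]]]].
have t0 : 0 <= t%:num by [].
have t1 : 0 <= 1 - t%:num by rewrite subr_ge0.
have fle p q : J p -> J q -> p <= q -> f p <= f q.
  move=> Jp Jq; rewrite le_eqVlt => /predU1P[->//|pq].
  exact/ltW/fi.
have [e [Je ea ec]] : exists e, [/\ J e, f e <= f a & f e <= f c].
  have [ac|ca] := leP a c; first by exists a; split=> //; exact: fle.
  by exists c; split=> //; apply: fle => //; exact: ltW.
have [g [Jg bg dg]] : exists g, [/\ J g, f b <= f g & f d <= f g].
  have [bd|db] := leP b d; first by exists d; split=> //; exact: fle.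
  by exists b; split=> //; apply: fle => //; exact: ltW.
exists e, g; split => //.
have -> : z <| t |> w = t%:num * z + (1 - t%:num) * w :> R by [].
have ez := le_trans ea az; have ew := le_trans ec cw.
have zg := le_trans zb bg; have wg := le_trans wd dg.
apply/andP; split.
  have -> : f e = t%:num * f e + (1 - t%:num) * f e.
    by rewrite -mulrDl addrC subrK mul1r.
  by apply: lerD; apply: ler_wpM2l.
have -> : f g = t%:num * f g + (1 - t%:num) * f g.
  by rewrite -mulrDl addrC subrK mul1r.
by apply: lerD; apply: ler_wpM2l.
Qed.

Let f_le x y : J x -> J y -> f x <= f y -> x <= y.
Proof.
by move=> Jx Jy; apply: contraTT; rewrite -!ltNge => /(fi Jy Jx).
Qed.

Lemma is_gen_inverse_ex : exists g, is_gen_inverse J f g.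
Proof.
pose S y := [set x | J x /\ f x <= y].
have S_ub y : conv_hull (f @` J) y -> exists2 b, J b & ubound (S y) b.
  move=> /conv_hull_le[a [b [Ja Jb /andP[ay yb]]]]; exists b => // x [Jx xy].
  exact: f_le (le_trans xy yb).
have S_ex y : conv_hull (f @` J) y -> exists2 a, J a & S y a.
  by move=> /conv_hull_le[a [b [Ja Jb /andP[ay yb]]]]; exists a.
have S_sup y : conv_hull (f @` J) y -> has_sup (S y).
  move=> hy; split; first by have [a _ ?] := S_ex _ hy; exists a.
  by have [b _ ?] := S_ub _ hy; exists b.
exists (fun y => sup (S y)); split.
- move=> y hy; have [a Ja Sa] := S_ex _ hy; have [b Jb Sb] := S_ub _ hy.
  apply: (Jitv Ja Jb); apply/andP; split.
    by apply: ub_le_sup => //; exact: (S_sup _ hy).2.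
  by apply: ge_sup => //; exists a.
- move=> y z hy hz yz; apply: ge_sup; first exact: (S_sup _ hy).1.
  move=> x [Jx xy]; apply: ub_le_sup; first exact: (S_sup _ hz).2.
  by split => //; exact: le_trans yz.
- move=> x Jx; apply/eqP; rewrite eq_le; apply/andP; split.
    by apply: ge_sup; [exists x|move=> z [Jz /f_le]; exact].
  by apply: ub_le_sup; [exists x => z [Jz /f_le]; exact|split].
Qed.

Lemma is_gen_inverse_uniq g h : is_gen_inverse J f g -> is_gen_inverse J f h ->
  forall y, conv_hull (f @` J) y -> g y = h y.
Proof.
have sub x : J x -> conv_hull (f @` J) (f x).
  by move=> Jx; apply: sub_gen_smallest; exists x.
have le_inv g' h' : is_gen_inverse J f g' -> is_gen_inverse J f h' ->
    forall y, conv_hull (f @` J) y -> g' y <= h' y.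
  move=> [gJ gi gf] [hJ hi hf] y hy; rewrite leNgt; apply/negP => hg.
  pose m := (h' y + g' y) / 2.
  have hm : h' y < m by rewrite midf_lt.
  have mg : m < g' y by rewrite midf_lt.
  have Jm : J m by apply: (Jitv (hJ _ hy) (gJ _ hy)); rewrite !ltW.
  have [my|ym] := leP (f m) y.
    by have := hi _ _ (sub _ Jm) hy my; rewrite hf// leNgt hm.
  by have := gi _ _ hy (sub _ Jm) (ltW ym); rewrite gf// leNgt mg.
by move=> Hg Hh y hy; apply/eqP; rewrite eq_le !le_inv.
Qed.

Lemma gen_inverseP : is_gen_inverse J f (gen_inverse J f).
Proof. by have [g gP] := is_gen_inverse_ex; exact: (xgetI _ gP). Qed.

End gen_inverse_wd.

(* Main.v *)
Require Import Defs.
From HB Require Import structures.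
From mathcomp Require Import all_boot all_order all_algebra.
From mathcomp Require Import all_classical all_reals all_analysis.
From mathcomp Require Import ring lra.
Import Order.TTheory GRing.Theory Num.Theory.
Import numFieldNormedType.Exports.
Local Open Scope classical_set_scope.
Local Open Scope ring_scope.

(** Write g_j for the generalized inverse of f_j.  The implications
    (b) => (a) => (c) are specializations: equal weights, then n = 2.

    (d) => (b) is Jensen's inequality for Psi ([concave_wavg]) at the points
    u_i = (f_1(x_i1), ..., f_k(x_ik)).  By continuity the weighted average of
    the u_i is again of the form (f_1(z_1), ..., f_k(z_k)), where z_j is the
    j-th weighted mean, and Jensen's inequality bounds the weighted average of
    the f_0(x_i1 ... x_ik) by f_0(z_1 ... z_k).  Applying g_0 gives (b).

    (c) => (d) has two parts.  Concavity, once continuity is known: (c) says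
    that Psi is midpoint concave, and Psi is bounded below on segments because
    it is monotone in each coordinate; this suffices for concavity
    ([midconcave_concave]).

    Continuity: take x_j = y_j in (c) for all j but one, say i.  With C the
    product of the x_j for j != i, this leaves an inequality for f_0 and f_i,
      g_0((f_0(C s) + f_0(C t))/2) <= C g_i((f_i(s) + f_i(t))/2).
    If f_0 jumps at C q, the left-hand side is at least C q for all t > q and
    s < q close enough to q, whereas the right-hand side is smaller than C q
    for t close enough to q, given s, if f_i is continuous at q.  Hence
    continuity of f_i at q passes to f_0 at C q ([tight_outer]), and
    symmetrically continuity of f_0 at C q passes to f_i at q ([tight_inner]).
    When k >= 2 every C > 0 occurs; an increasing function is continuous at some
    point q, so choosing C = p / q makes f_0 continuous at an arbitrary p, and
    C = 1 then makes each f_i continuous everywhere.  When k = 1 only C = 1 occurs, and continuity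
    passes between f_0 and f_1 point by point. *)

(** * Concave functions and Jensen's inequality *)

Section convexity.
Context {R : realType} {V : lmodType R}.
Implicit Types (D : set (convex_lmodType V)) (F : V -> R).

Lemma convex_setP D : convex_set D <->
  (forall (u v : V) (t : R), 0 <= t <= 1 -> D u -> D v ->
     D (t *: u + (1 - t) *: v)).
Proof.
split=> [cD u v t /andP[t0 t1] Du Dv|cD u v t].
  by have := cD u v (Itv01 t0 t1); rewrite !inE; exact.
by rewrite !inE => Du Dv; apply: cD => //; apply/andP; split.
Qed.

Lemma concave_functionP D F : concave_function D F <->
  (forall (u v : V) (t : R), 0 <= t <= 1 -> D u -> D v ->
     t * F u + (1 - t) * F v <= F (t *: u + (1 - t) *: v)).
Proof.
have convE t u v : - F u * t + - F v * (1 - t) = - (t * F u + (1 - t) * F v).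
  by ring.
split=> [cF u v t /andP[t0 t1] Du Dv|cF t u v].
  have := cF (Itv01 t0 t1) u v; rewrite !inE => /(_ Du Dv).
  by rewrite convRE !mulrN -opprD lerN2.
rewrite !inE => Du Dv; rewrite convRE !mulrN -opprD lerN2.
by apply: cF => //; apply/andP; split.
Qed.

(** The weights are not normalized and some may vanish: if all but the first
    vanish, the average is a single point; otherwise split off the first point
    and average it with the average of the others. *)
Lemma convex_set_wavg D n (l : 'I_n -> R) (u : 'I_n -> V) : convex_set D ->
  (forall i, 0 <= l i) -> 0 < \sum_i l i -> (forall i, D (u i)) ->
  D ((\sum_i l i)^-1 *: \sum_i l i *: u i).
Proof.
move=> /convex_setP cD; elim: n l u => [|n IHn] l u l_ge0 l_gt0 Du.
  by rewrite big_ord0 ltxx in l_gt0.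
move: l_gt0; rewrite !big_ord_recl.
set l0 := l ord0; set S := \sum_(i < n) _ => l_gt0.
have : 0 <= S by apply: sumr_ge0.
rewrite le_eqVlt => /predU1P[/esym S0|S_gt0].
  have l'0 i : l (lift ord0 i) = 0.
    exact: (psumr_eq0P (fun i _ => l_ge0 (lift ord0 i)) S0).
  have -> : \sum_(i < n) l (lift ord0 i) *: u (lift ord0 i) = 0.
    by apply: big1 => i _; rewrite l'0 scale0r.
  move: l_gt0; rewrite S0 !addr0 => l_gt0.
  by rewrite scalerA mulVf ?scale1r ?gt_eqF.
have := IHn _ _ (fun i => l_ge0 (lift ord0 i)) S_gt0
  (fun i => Du (lift ord0 i)).
rewrite -/S; set w := _ *: _ => Dw.
have -> : \sum_(i < n) l (lift ord0 i) *: u (lift ord0 i) = S *: w.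
  by rewrite /w scalerA divff ?scale1r ?gt_eqF.
have -> : (l0 + S)^-1 *: (l0 *: u ord0 + S *: w) =
    (l0 / (l0 + S)) *: u ord0 + (1 - l0 / (l0 + S)) *: w.
  rewrite scalerDr !scalerA; congr (_ *: _ + _ *: _); field;
  by rewrite ?(gt_eqF l_gt0) ?(gt_eqF S_gt0).
apply: cD => //; rewrite divr_ge0 ?l_ge0 ?(ltW l_gt0)//=.
by rewrite ler_pdivrMr// mul1r lerDl ltW.
Qed.

End convexity.

(** Jensen's inequality is [convex_set_wavg] for the hypograph of [F]. *)
Lemma concave_wavg {R : realType} {V : lmodType R}
    (D : set (convex_lmodType V)) (F : V -> R) n (l : 'I_n -> R)
    (u : 'I_n -> V) : convex_set D -> concave_function D F ->
  (forall i, 0 <= l i) -> 0 < \sum_i l i -> (forall i, D (u i)) ->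
  (\sum_i l i * F (u i)) / \sum_i l i <=
  F ((\sum_i l i)^-1 *: \sum_i l i *: u i).
Proof.
move=> cD cF l_ge0 l_gt0 Du.
pose H : set (convex_lmodType (V * R^o)%type) :=
  [set p | D p.1 /\ p.2 <= F p.1].
have cH : convex_set H.
  apply/convex_setP => -[u1 r1] [u2 r2] t t01 [/= Du1 r1F] [/= Du2 r2F].
  split=> /=; first by move/convex_setP: cD; exact.
  have /andP[t0 t1] := t01.
  apply: le_trans ((concave_functionP D F).1 cF _ _ _ t01 Du1 Du2).
  by apply: lerD; apply: ler_wpM2l => //; rewrite subr_ge0.
have [] := @convex_set_wavg _ _ H n l (fun i => (u i, F (u i))) cH l_ge0 l_gt0
  (fun i => conj (Du i) (lexx _)).
have fstE : (\sum_i l i *: (u i, F (u i) : R^o)).1 = \sum_i l i *: u i.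
  exact: (big_morph (fun p : V * R^o => p.1) (fun _ _ => erefl) erefl).
have sndE : (\sum_i l i *: (u i, F (u i) : R^o)).2 = \sum_i l i * F (u i).
  exact: (big_morph (fun p : V * R^o => p.2) (fun _ _ => erefl) erefl).
by move=> _ /=; rewrite fstE sndE mulrC.
Qed.

(** A lower bound m can be improved to m / 2: every t in [0, 1] is the midpoint
    of 0 and 2t or of 1 and 2t - 1, where one endpoint has a nonnegative value
    and the other one at least m.  So the infimum is nonnegative. *)
Lemma midconcave_ge0 {R : realType} (phi : R -> R) (m : R) :
  0 <= phi 0 -> 0 <= phi 1 ->
  (forall s t : R, 0 <= s <= 1 -> 0 <= t <= 1 ->
     (phi s + phi t) / 2 <= phi ((s + t) / 2)) ->
  (forall t : R, 0 <= t <= 1 -> m <= phi t) ->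
  forall t : R, 0 <= t <= 1 -> 0 <= phi t.
Proof.
move=> phi0 phi1 mid phi_ge.
pose E := [set phi t | t in [set t | 0 <= t <= 1]].
have E_lb : has_lbound E by exists m => _ [t t01 <-]; exact: phi_ge.
have E_neq0 : E !=set0 by exists (phi 0), 0 => //=; rewrite lexx ler01.
have infE t : 0 <= t <= 1 -> inf E <= phi t.
  by move=> t01; apply: ge_inf => //; exists t.
suff inf_ge0 : inf E / 2 <= inf E.
  by move=> t /infE; apply: le_trans; lra.
apply: lb_le_inf => // _ [t /= t01 <-].
have [t2|t2] := leP t 2^-1.
  have s01 : 0 <= 2 * t <= 1 by lra.
  have := mid 0 (2 * t) _ s01; rewrite lexx ler01 => /(_ isT).
  have -> : (0 + 2 * t) / 2 = t by field.
  by have := infE _ s01; lra.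
have s01 : 0 <= 2 * t - 1 <= 1 by lra.
have := mid 1 (2 * t - 1) _ s01; rewrite lexx ler01 => /(_ isT).
have -> : (1 + (2 * t - 1)) / 2 = t by field.
by have := infE _ s01; lra.
Qed.

(** Along a segment, the difference between [F] and its chord is midpoint
    concave, bounded below and zero at both ends: [midconcave_ge0] applies. *)
Lemma midconcave_concave {R : realType} {V : lmodType R}
    (D : set (convex_lmodType V)) (F : V -> R) : convex_set D ->
  (forall u v : V, D u -> D v -> (F u + F v) / 2 <= F (2^-1 *: (u + v))) ->
  (forall u v : V, D u -> D v ->
     exists m, forall t : R, 0 <= t <= 1 -> m <= F (t *: u + (1 - t) *: v)) ->
  concave_function D F.
Proof.
move=> /convex_setP cD mid bnd; apply/concave_functionP => u v t t01 Du Dv.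
have [m Fm] := bnd _ _ Du Dv.
pose phi (t : R) := F (t *: u + (1 - t) *: v) - (t * F u + (1 - t) * F v).
rewrite -subr_ge0; apply: (@midconcave_ge0 _ phi (m - (`|F u| + `|F v|))) => //.
- by rewrite /phi !scale0r !add0r subr0 scale1r mul0r mul1r add0r subrr.
- by rewrite /phi subrr !scale0r addr0 scale1r mul0r mul1r addr0 subrr.
- move=> s r s01 r01; rewrite /phi.
  have := mid _ _ (cD _ _ _ s01 Du Dv) (cD _ _ _ r01 Du Dv).
  rewrite (_ : 2^-1 *: _ = ((s + r) / 2) *: u + (1 - (s + r) / 2) *: v).
    by lra.
  rewrite addrACA -!scalerDl scalerDr !scalerA.
  by congr (_ *: _ + _ *: _); field.
- move=> s s01; rewrite /phi; apply: lerB; first exact: Fm.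
  have le_norm a (x : R) : 0 <= a <= 1 -> a * x <= `|x|.
    move=> /andP[a0 a1]; apply: le_trans (ler_norm _) _.
    by rewrite normrM (ger0_norm a0) ler_piMl.
  by apply: lerD; apply: le_norm; lra.
Qed.

(** * Generalized inverses of strictly increasing functions *)

Section gen_inverse_theory.
Context {R : realType} {J : set R} {f : R -> R}.
Hypotheses (Jitv : is_interval J) (fi : strictly_increasing J f).
Let g := gen_inverse J f.
Let gP : is_gen_inverse J f g := gen_inverseP Jitv fi.

Lemma strictly_increasing_le x y : J x -> J y -> (f x <= f y) = (x <= y).
Proof.
move=> Jx Jy; have [xy|yx] := leP x y; last by apply/lt_geF/fi.
move: xy; rewrite le_eqVlt => /predU1P[->|/(fi _ _ Jx Jy)/ltW//].
by rewrite lexx.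
Qed.

Lemma strictly_increasing_inj : {in J &, injective f}.
Proof.
move=> x y /[!inE] Jx Jy /eqP; rewrite eq_le !strictly_increasing_le// -eq_le.
by move/eqP.
Qed.

Lemma convex_conv_hull :
  convex_set (conv_hull (f @` J) : set (convex_lmodType R^o)).
Proof.
move=> u v t; rewrite !inE => hu hv C [cC sub].
by have := cC u v t; rewrite !inE; apply; [apply: hu|apply: hv].
Qed.

Lemma conv_hull_image x : J x -> conv_hull (f @` J) (f x).
Proof. by move=> Jx; apply: sub_gen_smallest; exists x. Qed.

Lemma conv_hull_mid x y : J x -> J y -> conv_hull (f @` J) ((f x + f y) / 2).
Proof.
move=> Jx Jy; have /convex_setP cH := convex_conv_hull.
rewrite (_ : _ / 2 = 2^-1 * f x + (1 - 2^-1) * f y); last by field.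
by apply: cH; [lra|exact: conv_hull_image..].
Qed.

Lemma gen_inverse_in y : conv_hull (f @` J) y -> J (g y).
Proof. by case: gP => + _ _; exact. Qed.

Lemma gen_inverseK x : J x -> g (f x) = x.
Proof. by case: gP => _ _; exact. Qed.

Lemma gen_inverse_le x y : J x -> conv_hull (f @` J) y -> y <= f x -> g y <= x.
Proof.
move=> Jx hy yx; rewrite -[leRHS](gen_inverseK _ Jx).
by case: gP => _ + _; apply => //; exact: conv_hull_image.
Qed.

Lemma gen_inverse_ge x y : J x -> conv_hull (f @` J) y -> f x <= y -> x <= g y.
Proof.
move=> Jx hy yx; rewrite -[leLHS](gen_inverseK _ Jx).
by case: gP => _ + _; apply => //; exact: conv_hull_image.
Qed.

Lemma qamean2E x y :
  qamean J f [tuple x; y] = gen_inverse J f ((f x + f y) / 2).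
Proof. by rewrite /qamean !big_ord_recl big_ord0 addr0. Qed.

End gen_inverse_theory.

(** * Continuity of increasing functions on the positive reals *)

Section increasing_on_Rpos.
Context {R : realType}.
Implicit Types (f : R -> R) (p x y e : R).

(** Continuity at [p] of an increasing function, as vanishing oscillation: the
    jump f(p+) - f(p-) is zero.  In this form both continuity and its failure
    ([ntightP]) give inequalities that hold on the two sides of [p]. *)
Definition tight f p := forall e, 0 < e ->
  exists x y, [/\ 0 < x, x < p, p < y & f y - f x < e].

Lemma RposE x : Rpos R x = (0 < x).
Proof. by rewrite /Rpos /= in_itv/= andbT. Qed.

Lemma Rpos_itv : is_interval (Rpos R).
Proof.
move=> x y /[!RposE] x0 y0 z /andP[xz _]; rewrite RposE.
exact: lt_le_trans xz.
Qed.

Lemma continuous_RposP f : strictly_increasing (Rpos R) f ->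
  {within Rpos R, continuous f} <-> forall p, 0 < p -> tight f p.
Proof.
move=> fi; rewrite continuous_open_subspace; last exact: interval_open.
have f_lt x y : 0 < x -> x < y -> f x < f y.
  by move=> x0 xy; apply: fi => //; rewrite RposE//; exact: lt_trans xy.
split=> [cf p p0 e e0|tf p].
  have /cvgrPdist_lt/(_ (e / 2)) : f x @[x --> p] --> f p.
    by apply: cf; rewrite inE RposE.
  rewrite divr_gt0// => /(_ isT) [d /= d0 dP].
  pose x := Num.max (p / 2) (p - d / 2).
  have xp : x < p by rewrite /x gt_max; apply/andP; split; lra.
  have x0 : 0 < x by rewrite /x lt_max; apply/orP; left; lra.
  have px : p - d / 2 <= x by rewrite /x le_max lexx orbT.
  exists x, (p + d / 2); split=> //; first lra.
  have fx : f p - f x < e / 2.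
    by apply/ltr_normlW/dP; rewrite /ball_/= gtr0_norm; lra.
  have fy : f (p + d / 2) - f p < e / 2.
    apply/ltr_normlW; rewrite distrC; apply/dP; rewrite /ball_/= distrC.
    by rewrite gtr0_norm; lra.
  lra.
rewrite inE RposE => p0; apply/cvgrPdist_lt => e e0.
have [x [y [x0 xp py xye]]] := tf p p0 e e0.
near=> z.
have xz : x < z by near: z; exact: lt_nbhsr.
have zy : z < y by near: z; exact: lt_nbhsl.
have := f_lt _ _ x0 xz; have := f_lt _ _ (lt_trans x0 xz) zy.
have := f_lt _ _ x0 xp; have := f_lt _ _ p0 py.
by rewrite ltr_norml => *; apply/andP; split; lra.
Unshelve. all: by end_near. Qed.

Lemma continuous_Rpos_image f x y v : {within Rpos R, continuous f} ->
  0 < x -> 0 < y -> f x <= v <= f y -> exists2 z, 0 < z & f z = v.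
Proof.
move=> cf x0 y0 /andP[xv vy].
have sub a b : 0 < a -> {within `[a, b], continuous f}.
  move=> a0; apply: continuous_subspaceW cf => z /=; rewrite RposE in_itv/=.
  by move=> /andP[az _]; exact: lt_le_trans az.
have [xy|/ltW yx] := leP x y.
  have [|z /[!in_itv]/= /andP[xz _] <-] := IVT xy (sub x y x0) (_ : _ <= v <= _).
    by rewrite ge_min xv le_max vy orbT.
  by exists z => //; exact: lt_le_trans xz.
have [|z /[!in_itv]/= /andP[xz _] <-] := IVT yx (sub y x y0) (_ : _ <= v <= _).
  by rewrite ge_min xv orbT le_max vy.
by exists z => //; exact: lt_le_trans xz.
Qed.

Lemma convex_continuous_image f : {within Rpos R, continuous f} ->
  convex_set (f @` Rpos R : set (convex_lmodType R^o)).
Proof.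
move=> cf; apply/convex_setP => _ _ t /andP[t0 t1] [x x0 <-] [y y0 <-].
rewrite !RposE in x0 y0.
have t'0 : 0 <= 1 - t by rewrite subr_ge0.
have [xy|/ltW yx] := leP (f x) (f y).
  have [|z z0 fz] :=
      continuous_Rpos_image f x y (t * f x + (1 - t) * f y) cf x0 y0.
    have d0 : 0 <= f y - f x by rewrite subr_ge0.
    have := mulr_ge0 t0 d0; have := mulr_ge0 t'0 d0.
    by move=> ? ?; apply/andP; split; lra.
  by exists z; rewrite ?RposE.
have [|z z0 fz] :=
    continuous_Rpos_image f y x (t * f x + (1 - t) * f y) cf y0 x0.
  have d0 : 0 <= f x - f y by rewrite subr_ge0.
  have := mulr_ge0 t0 d0; have := mulr_ge0 t'0 d0.
  by move=> ? ?; apply/andP; split; lra.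
by exists z; rewrite ?RposE.
Qed.

Lemma ntightP f p : ~ tight f p -> exists2 e, 0 < e &
  forall x y, 0 < x -> x < p -> p < y -> f x + e <= f y.
Proof.
move=> /existsNP[e /not_implyP[e0 nt]]; exists e => // x y x0 xp py.
rewrite leNgt; apply/negP => yx; apply: nt; exists x, y; split=> //; lra.
Qed.

Section jump.
Variables (f : R -> R) (p : R).
Hypotheses (fi : strictly_increasing (Rpos R) f) (p0 : 0 < p).

(** [f x] is within [e] of the left limit f(p-); with [ntightP] this says that,
    when [f] jumps by at least [e] at [p], the average of [f x] and any value
    taken to the right of [p] is not below f(p-). *)
Lemma near_left_sup e : 0 < e -> exists x, [/\ 0 < x, x < p &
  forall x', 0 < x' -> x' < p -> f x' < f x + e].
Proof.
move=> e0; pose E := [set f x | x in [set x | 0 < x < p]].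
have E_sup : has_sup E.
  split.
    by exists (f (p / 2)), (p / 2) => //=; apply/andP; move: p0; split; lra.
  exists (f p) => _ [x /= /andP[x0 xp] <-]; apply/ltW/fi => //;
  by rewrite RposE.
have [_ [x /= /andP[x0 xp] <-] xE] := sup_adherent e0 E_sup.
exists x; split=> // x' x'0 x'p.
have : f x' <= sup E.
  by apply: (ub_le_sup E_sup.2); exists x' => //=; rewrite x'0.
lra.
Qed.

Lemma near_right_inf e : 0 < e -> exists2 y, p < y &
  forall y', p < y' -> f y < f y' + e.
Proof.
move=> e0; pose E := [set f y | y in [set y | p < y]].
have E_inf : has_inf E.
  split; first by exists (f (p + 1)), (p + 1) => //=; rewrite ltrDl.
  exists (f p) => _ [y /= py <-]; apply/ltW/fi; rewrite ?RposE//.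
  exact: lt_trans py.
have [_ [y /= py <-] yE] := inf_adherent e0 E_inf.
exists y => // y' py'.
have : inf E <= f y' by apply: (ge_inf E_inf.2); exists y'.
lra.
Qed.

End jump.

(** On ]1, 2[ the discontinuities of a monotone function form a countable set,
    whereas the interval has positive Lebesgue measure. *)
Lemma tight_ex f : strictly_increasing (Rpos R) f ->
  exists2 q, 0 < q & tight f q.
Proof.
move=> fi; apply: contrapT => nt.
have f_lt x y : 0 < x -> x < y -> f x < f y.
  by move=> x0 xy; apply: fi => //; rewrite RposE//; exact: lt_trans xy.
have nd : {in `[1, 2] &, {homo f : x y / x <= y}}.
  move=> x y /[!in_itv]/= /andP[x1 _] _; rewrite le_eqVlt => /predU1P[->//|xy].
  by apply/ltW/f_lt => //; lra.
have disc : `]1, 2[%classic `<=` [set x | x \in (`]1, 2[) /\ discontinuity f x].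
  move=> p p12; split=> //; move: p12; rewrite /= in_itv/= => /andP[p1 p2].
  have p0 : 0 < p by lra.
  have [e e0 fe] : exists2 e, 0 < e &
      forall x y, 0 < x -> x < p -> p < y -> f x + e <= f y.
    by apply: ntightP => tp; apply: nt; exists p.
  have cl : cvg (f x @[x --> p^'-]).
    apply: nondecreasing_at_left_is_cvgr; near=> x.
      move=> y z /[!in_itv]/= /andP[xy _] _; rewrite le_eqVlt => /predU1P[->//|yz].
      by apply/ltW/f_lt => //; apply: lt_trans xy; near: x; exact: nbhs_left_gt.
    exists (f p) => _ [y /= /[!in_itv]/= /andP[xy yp] <-]; apply/ltW/f_lt => //.
    by apply: lt_trans xy; near: x; exact: nbhs_left_gt.
  have cr : cvg (f x @[x --> p^'+]).
    apply: nondecreasing_at_right_is_cvgr; near=> x.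
      move=> y z /[!in_itv]/= /andP[py _] _; rewrite le_eqVlt => /predU1P[->//|yz].
      by apply/ltW/f_lt => //; exact: lt_trans py.
    by exists (f p) => _ [y /= /[!in_itv]/= /andP[py _] <-]; exact/ltW/f_lt.
  split=> //; apply/eqP => lrE.
  have e2 : 0 < e / 2 by rewrite divr_gt0.
  move/cvgrPdist_lt/(_ _ e2) : cl => cl.
  move/cvgrPdist_lt/(_ _ e2) : cr; rewrite -lrE => cr.
  have [x [x0 xp fx]] : exists x, [/\ 0 < x, x < p &
      `|lim (f x @[x --> p^'-]) - f x| < e / 2].
    near p^'- => x; exists x; split; [|by []|]; near: x => //.
    exact: nbhs_left_gt.
  have [y [py fy]] : exists y, p < y /\
      `|lim (f x @[x --> p^'-]) - f y| < e / 2.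
    by near p^'+ => y; exists y; split; [|near: y].
  have := fe _ _ x0 xp py; move: fx fy; rewrite !ltr_norml; lra.
have := sub_countable (subset_card_le disc) (discontinuity_countable nd).
move=> /countable_lebesgue_measure0/eqP.
rewrite lebesgue_measure_itv/= lte_fin ltr1n/= -EFinB eqe subr_eq0.
by rewrite (eqr_nat _ 2 1).
Unshelve. all: by end_near. Qed.

End increasing_on_Rpos.

(** * Transfer of continuity between two functions *)

Section continuity_transfer.
Context {R : realType}.
Variables (F h : R -> R) (C q : R).
Hypotheses (Fi : strictly_increasing (Rpos R) F)
  (hi : strictly_increasing (Rpos R) h) (C0 : 0 < C) (q0 : 0 < q).
Hypothesis mean_le : forall s t, 0 < s -> 0 < t ->
  gen_inverse (Rpos R) F ((F (C * s) + F (C * t)) / 2) <=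
  C * gen_inverse (Rpos R) h ((h s + h t) / 2).

Local Notation J := (Rpos R).
Let Jitv : is_interval J := @Rpos_itv R.
Let JP (x : R) : 0 < x -> J x. Proof. by rewrite RposE. Qed.
Let Cq0 : 0 < C * q. Proof. exact: mulr_gt0. Qed.

(** If [F] jumps at [C * q], its mean at [C * s] and [C * t] is at least [C * q]
    for s < q close to q and all t > q; continuity of [h] at [q] lets [t] be so
    close to [q] that the mean of [h] at [s] and [t] stays below [q]. *)
Lemma tight_outer : tight h q -> tight F (C * q).
Proof.
move=> th; apply: contrapT => /ntightP[e e0 Fe].
have [x [x0 xp Fx]] := near_left_sup F (C * q) Fi Cq0 e e0.
pose s := x / C.
have s0 : 0 < s by rewrite divr_gt0.
have Cs : C * s = x by rewrite /s mulrC divfK ?gt_eqF.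
have sq : s < q by rewrite /s ltr_pdivrMr// mulrC.
(* [h] oscillates around [q] by less than half of [h q - h s], so that the
   average of [h s] and [h t] is below [h z] although [z] is below [q]. *)
have hsq : 0 < (h q - h s) / 2.
  by rewrite divr_gt0// subr_gt0; apply: hi => //; exact: JP.
have [z [t [z0 zq qt htz]]] := th _ hsq.
have t0 : 0 < t := lt_trans q0 qt.
have hqt : h q < h t by apply: hi => //; exact: JP.
have pt : C * q < C * t by rewrite ltr_pM2l.
have : C * q <= gen_inverse J F ((F (C * s) + F (C * t)) / 2).
  rewrite leNgt; apply/negP; set w := gen_inverse _ _ _ => wp.
  have hw : conv_hull (F @` J) ((F (C * s) + F (C * t)) / 2).
    by apply: conv_hull_mid; apply: JP; exact: mulr_gt0.
  have w0 : 0 < w by rewrite -RposE; exact: (gen_inverse_in Jitv Fi).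
  pose x' := (w + C * q) / 2.
  have x'0 : 0 < x' by rewrite divr_gt0// addr_gt0.
  have wx' : w < x' by rewrite midf_lt.
  have x'p : x' < C * q by rewrite midf_lt.
  have : x' <= w.
    apply: (gen_inverse_ge Jitv Fi) => //; first exact: JP.
    by have := Fx _ x'0 x'p; have := Fe _ _ x'0 x'p pt; rewrite Cs; lra.
  by rewrite leNgt wx'.
move=> /le_trans/(_ (mean_le _ _ s0 t0)); rewrite ler_pM2l//.
have gz : gen_inverse J h ((h s + h t) / 2) <= z.
  apply: (gen_inverse_le Jitv hi); first exact: JP.
    by apply: conv_hull_mid; exact: JP.
  lra.
by move=> /le_trans/(_ gz); rewrite leNgt zq.
Qed.

(** The mirror image of [tight_outer]: if [h] jumps at [q], its mean at [s] and
    [t] is at most [q] for t > q close to q and all s < q, whereas continuity of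
    [F] at [C * q] pushes the mean of [F] above [C * q] when [s] is close to
    [q]. *)
Lemma tight_inner : tight F (C * q) -> tight h q.
Proof.
move=> tF; apply: contrapT => /ntightP[e e0 he].
have [t qt ht] := near_right_inf h q hi q0 e e0.
have t0 : 0 < t := lt_trans q0 qt.
have pt : C * q < C * t by rewrite ltr_pM2l.
have Fpt : 0 < (F (C * t) - F (C * q)) / 2.
  by rewrite divr_gt0// subr_gt0; apply: Fi => //; apply: JP; exact: mulr_gt0.
have [x [y [x0 xp py Fxy]]] := tF _ Fpt.
have y0 : 0 < y := lt_trans Cq0 py.
have Fxp : F x < F (C * q) by apply: Fi => //; exact: JP.
pose s := x / C.
have s0 : 0 < s by rewrite divr_gt0.
have Cs : C * s = x by rewrite /s mulrC divfK ?gt_eqF.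
have sq : s < q by rewrite /s ltr_pdivrMr// mulrC.
have : gen_inverse J h ((h s + h t) / 2) <= q.
  rewrite leNgt; apply/negP; set w := gen_inverse _ _ _ => qw.
  have hw : conv_hull (h @` J) ((h s + h t) / 2).
    by apply: conv_hull_mid; exact: JP.
  pose t' := (q + w) / 2.
  have qt' : q < t' by rewrite midf_lt.
  have t'w : t' < w by rewrite midf_lt.
  have : w <= t'.
    apply: (gen_inverse_le Jitv hi) => //; first exact/JP/(lt_trans q0).
    by have := ht _ qt'; have := he _ _ s0 sq qt'; lra.
  by rewrite leNgt t'w.
rewrite -(ler_pM2l C0) => /(le_trans (mean_le _ _ s0 t0)).
have yg : y <= gen_inverse J F ((F (C * s) + F (C * t)) / 2).
  apply: (gen_inverse_ge Jitv Fi); first exact: JP.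
    by apply: conv_hull_mid; apply: JP; exact: mulr_gt0.
  by rewrite Cs; lra.
by move=> /(le_trans yg); rewrite leNgt py.
Qed.

End continuity_transfer.

(** * Products of means *)

Section product_means.
Context {R : realType} {k : nat}.
Variable f : 'I_k.+1 -> R -> R.
Hypothesis hf : forall j, strictly_increasing (Rpos R) (f j).

Local Notation J := (Rpos R).
Let Jitv : is_interval J := @Rpos_itv R.
Let JP (x : R) : 0 < x -> J x. Proof. by rewrite RposE. Qed.
Let JP' x : J x -> 0 < x. Proof. by rewrite RposE. Qed.
Let prod_gt0 (x : 'I_k -> R) : (forall j, 0 < x j) -> 0 < \prod_(j < k) x j.
Proof. by move=> x0; apply: prodr_gt0. Qed.

Definition outer_values (x : 'I_k -> R) : 'rV[R]_k :=
  \row_j f (lift ord0 j) (x j).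

Lemma Psi_domP (u : 'rV[R]_k) : Psi_dom J f u <->
  exists2 x : 'I_k -> R, (forall j, 0 < x j) & u = outer_values x.
Proof.
split=> [Du|[x x0 ->] j]; last by rewrite mxE; exists (x j) => //; exact: JP.
have /choice[x xP] : forall j, exists x, J x /\ f (lift ord0 j) x = u ord0 j.
  by move=> j; have [x ? ?] := Du j; exists x.
exists x => [j|]; first by apply: JP'; have [] := xP j.
by apply/rowP => j; rewrite mxE; have [] := xP j.
Qed.

Lemma Psi_outer_values (x : 'I_k -> R) : (forall j, 0 < x j) ->
  Psi J f (outer_values x) = f ord0 (\prod_(j < k) x j).
Proof.
move=> x0; rewrite /Psi; congr f; apply: eq_bigr => j _; rewrite mxE.
by apply: pinvKV; [exact: strictly_increasing_inj|rewrite inE; exact: JP].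
Qed.

(** A product of intervals: each f_j has the intermediate value property. *)
Lemma convex_Psi_dom : (forall j, {within J, continuous (f j)}) ->
  convex_set (Psi_dom J f : set (convex_lmodType 'rV[R]_k)).
Proof.
move=> cf; apply/convex_setP => u v t t01 Du Dv j; rewrite !mxE.
have /convex_setP := convex_continuous_image _ (cf (lift ord0 j)).
by apply.
Qed.

Definition two_point_inequality :=
  forall x y : 'I_k -> R,
  (forall j, J (x j)) -> (forall j, J (y j)) ->
  qamean J (f ord0) [tuple \prod_(j < k) x j; \prod_(j < k) y j]
  <= \prod_(j < k) qamean J (f (lift ord0 j)) [tuple x j; y j].

(** Where both points have the same coordinate, the mean is that coordinate. *)
Lemma one_coordinate_inequality (i : 'I_k) (c : 'I_k -> R) (C s t : R) :
  two_point_inequality ->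
  (forall j, 0 < c j) -> 0 < s -> 0 < t ->
  \prod_(j < k | j != i) c j = C ->
  gen_inverse J (f ord0) ((f ord0 (C * s) + f ord0 (C * t)) / 2) <=
  C * gen_inverse J (f (lift ord0 i))
        ((f (lift ord0 i) s + f (lift ord0 i) t) / 2).
Proof.
move=> ineq c0 s0 t0 prodc.
pose x r j := if j == i then r else c j : R.
have xJ r : 0 < r -> forall j, J (x r j).
  by move=> r0 j; rewrite /x; case: ifP => _; exact: JP.
have prodx r : \prod_(j < k) x r j = C * r.
  rewrite (bigD1 i)//= {1}/x eqxx mulrC; congr (_ * _).
  by rewrite -prodc; apply: eq_bigr => j /negbTE ji; rewrite /x ji.
have := ineq _ _ (xJ _ s0) (xJ _ t0); rewrite !prodx qamean2E.
rewrite (bigD1 i)//= qamean2E {1 2}/x eqxx [leRHS]mulrC.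
suff -> : \prod_(j < k | j != i)
  qamean J (f (lift ord0 j)) [tuple x s j; x t j] = C by [].
rewrite -prodc; apply: eq_bigr => j /negbTE ji; rewrite qamean2E /x ji.
have -> : (f (lift ord0 j) (c j) + f (lift ord0 j) (c j)) / 2 =
    f (lift ord0 j) (c j).
  by field.
by apply: gen_inverseK => //; exact: JP.
Qed.

(** The product of all the coordinates but one takes every positive value when
    k >= 2, but only the value 1 when k = 1; this is why the extra hypothesis is
    asked for k = 1. *)
Lemma two_point_continuous : (1 <= k)%N -> two_point_inequality ->
  (k = 1%N -> exists j, {within J, continuous (f j)}) ->
  forall j, {within J, continuous (f j)}.
Proof.
move=> k_gt0 ineq hk1.
have Cineq (i : 'I_k) (C : R) : 0 < C -> (1 < k)%N || (C == 1) ->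
  forall s t : R, 0 < s -> 0 < t ->
  gen_inverse J (f ord0) ((f ord0 (C * s) + f ord0 (C * t)) / 2) <=
  C * gen_inverse J (f (lift ord0 i))
        ((f (lift ord0 i) s + f (lift ord0 i) t) / 2).
  move=> C0 kC s t s0 t0.
  suff [c c0 prodc] : exists2 c : 'I_k -> R, (forall j, 0 < c j) &
      \prod_(j < k | j != i) c j = C.
    by have := one_coordinate_inequality i c C s t ineq c0 s0 t0 prodc.
  have [k1|/eqP ->] := orP kC; last by exists (fun=> 1) => //; rewrite big1.
  have [i' i'i] : exists i' : 'I_k, i' != i.
    have : (0 < #|predC1 i|)%N by rewrite cardC1 card_ord; case: k k1 => [|[]].
    by move=> /card_gt0P[i']; exists i'.
  exists (fun j => if j == i' then C else 1) => [j|]; first by case: ifP.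
  rewrite (bigD1 i')//= eqxx big1 ?mulr1// => j /andP[_ /negbTE ->] //.
have inner j : {within J, continuous (f ord0)} ->
    {within J, continuous (f (lift ord0 j))}.
  move=> /(continuous_RposP _ (hf _)) tf0.
  apply/(continuous_RposP _ (hf _)) => p p0.
  apply: (tight_inner (f ord0) _ 1) => //; last by rewrite mul1r; exact: tf0.
  by apply: Cineq; rewrite ?eqxx ?orbT.
suff cf0 : {within J, continuous (f ord0)}.
  by move=> j; have [j' ->|->//] := unliftP ord0 j; exact: inner.
have [k1|] := ltnP 1 k.
  pose i := Ordinal k_gt0.
  have [q q0 tq] := tight_ex _ (hf (lift ord0 i)).
  apply/(continuous_RposP _ (hf _)) => p p0.
  have pq0 : 0 < p / q by rewrite divr_gt0.
  rewrite -(divfK (lt0r_neq0 q0) p).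
  apply: (tight_outer (f ord0) (f (lift ord0 i))) => //.
  by apply: Cineq; rewrite ?k1.
move=> k_le1; have k1 : k = 1%N by apply/eqP; rewrite eqn_leq k_le1.
have [j] := hk1 k1.
have [j' ->|->//] := unliftP ord0 j.
move=> /(continuous_RposP _ (hf _)) tfj.
apply/(continuous_RposP _ (hf _)) => p p0; rewrite -[p]mul1r.
apply: (tight_outer _ (f (lift ord0 j'))) => //; last exact: tfj.
by apply: Cineq; rewrite ?eqxx ?orbT.
Qed.

(** The two-point inequality is midpoint concavity of [Psi] in the variables
    u_j = f_j(x_j).  The lower bound on a segment comes from monotonicity: the
    value of [Psi] at the coordinatewise minimum of the endpoints. *)
Lemma two_point_concave : two_point_inequality ->
  (forall j, {within J, continuous (f j)}) ->
  concave_function (Psi_dom J f) (Psi J f).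
Proof.
move=> ineq cf; apply: midconcave_concave.
- exact: convex_Psi_dom.
- move=> _ _ /Psi_domP[x x0 ->] /Psi_domP[y y0 ->].
  pose z j := qamean J (f (lift ord0 j)) [tuple x j; y j].
  have mid j a b : 0 < a -> 0 < b ->
      exists w, [/\ 0 < w, f j w = (f j a + f j b) / 2 &
        qamean J (f j) [tuple a; b] = w].
    move=> a0 b0; have /convex_setP := convex_continuous_image _ (cf j).
    move=> /(_ (f j a) (f j b) 2^-1) [|||w /JP' w0 fw].
    + lra.
    + by exists a => //; exact: JP.
    + by exists b => //; exact: JP.
    have fw' : f j w = (f j a + f j b) / 2.
      by rewrite fw -[LHS]/(2^-1 * f j a + (1 - 2^-1) * f j b); field.
    exists w; split => //; rewrite qamean2E -fw'.
    by apply: gen_inverseK => //; exact: JP.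
  have z0 j : 0 < z j.
    by rewrite /z; have [w [? _ ->]] := mid (lift ord0 j) _ _ (x0 j) (y0 j).
  have -> : 2^-1 *: (outer_values x + outer_values y) = outer_values z.
    apply/rowP => j; rewrite !mxE mulrC /z.
    by have [w [_ <- ->]] := mid (lift ord0 j) _ _ (x0 j) (y0 j).
  rewrite !Psi_outer_values//.
  have [w [w0 <- wE]] := mid ord0 _ _ (prod_gt0 _ x0) (prod_gt0 _ y0).
  rewrite (strictly_increasing_le (hf ord0)); [|exact: JP|exact/JP/prod_gt0].
  by rewrite -wE; apply: ineq => j; exact: JP.
- move=> u v Du Dv; have := (Du, Dv).
  move=> [/Psi_domP[x x0 uE] /Psi_domP[y y0 vE]].
  pose a j := Num.min (x j) (y j).
  have a0 j : 0 < a j by rewrite /a lt_min x0 y0.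
  exists (f ord0 (\prod_(j < k) a j)) => t t01.
  have /convex_setP/(_ _ _ _ t01 Du Dv)/Psi_domP[z z0 zE] := convex_Psi_dom cf.
  rewrite zE Psi_outer_values//.
  rewrite (strictly_increasing_le (hf ord0)); try exact/JP/prod_gt0.
  apply: ler_prod => j _; rewrite (ltW (a0 j))/=.
  rewrite -(strictly_increasing_le (hf (lift ord0 j))); [|exact/JP|exact/JP].
  have := congr1 (fun w : 'rV_k => w ord0 j) zE; rewrite uE vE !mxE => <-.
  have ax : f (lift ord0 j) (a j) <= f (lift ord0 j) (x j).
    by rewrite (strictly_increasing_le (hf _)) ?ge_min ?lexx//; exact: JP.
  have ay : f (lift ord0 j) (a j) <= f (lift ord0 j) (y j).
    by rewrite (strictly_increasing_le (hf _)) ?ge_min ?lexx ?orbT//; exact: JP.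
  have /andP[t0 t1] := t01; rewrite -subr_ge0 in t1.
  have -> : f (lift ord0 j) (a j) =
      t * f (lift ord0 j) (a j) + (1 - t) * f (lift ord0 j) (a j) by ring.
  by apply: lerD; apply: ler_wpM2l.
Qed.

(** By continuity the average of the points u_i lies in the domain of [Psi]; its
    coordinates are the images under the f_j of the weighted means z_j, and
    Jensen's inequality compares the average of the f_0(x_i1 ... x_ik) with
    f_0(z_1 ... z_k). *)
Lemma concave_wqamean_le (n : nat) (x : 'I_n -> 'I_k -> R) (l : 'I_n -> R) :
  (forall j, {within J, continuous (f j)}) ->
  concave_function (Psi_dom J f) (Psi J f) ->
  (forall i j, J (x i j)) -> weights R n l ->
  wqamean J (f ord0) [tuple \prod_(j < k) x i j | i < n] l
  <= \prod_(j < k) wqamean J (f (lift ord0 j)) [tuple x i j | i < n] l.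
Proof.
move=> cf conc xJ [l_ge0 [i0 li0]].
have x0 i j : 0 < x i j by apply: JP'.
have l_gt0 : 0 < \sum_i l i.
  rewrite (bigD1 i0)//= ltr_pwDl ?lt_neqAle 1?eq_sym ?li0 ?l_ge0//.
  exact: sumr_ge0.
pose u i := outer_values (x i).
have Du i : Psi_dom J f (u i) by apply/Psi_domP; exists (x i).
have cD := convex_Psi_dom cf.
have /Psi_domP[z z0 zE] := convex_set_wavg _ _ _ _ cD l_ge0 l_gt0 Du.
have := concave_wavg _ _ _ _ _ cD conc l_ge0 l_gt0 Du.
rewrite zE Psi_outer_values//.
under eq_bigr do rewrite Psi_outer_values//.
move=> le_f0.
have -> : \prod_(j < k) wqamean J (f (lift ord0 j)) [tuple x i j | i < n] l =
    \prod_(j < k) z j.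
  apply: eq_bigr => j _; rewrite /wqamean.
  under eq_bigr do rewrite tnth_mktuple.
  have := congr1 (fun w : 'rV_k => w ord0 j) zE; rewrite !mxE summxE.
  under [X in _ * X]eq_bigr do rewrite !mxE.
  rewrite mulrC => ->; apply: gen_inverseK => //; exact: JP.
rewrite /wqamean; under eq_bigr do rewrite tnth_mktuple.
apply: gen_inverse_le => //; first exact/JP/prod_gt0.
rewrite mulrC; apply: (@convex_set_wavg R R^o _ n l
  (fun i => f ord0 (\prod_(j < k) x i j))) => //.
  exact: convex_conv_hull.
by move=> i; apply: conv_hull_image; apply: JP; exact: prod_gt0.
Qed.

End product_means.

(** * Equal weights and two points *)

Lemma qamean_wqamean {R : realType} (J : set R) (f : R -> R) (n : nat)
    (x : n.-tuple R) : qamean J f x = wqamean J f x (fun=> 1).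
Proof.
rewrite /qamean /wqamean sumr_const card_ord.
by under [in RHS]eq_bigr do rewrite mul1r.
Qed.

Lemma qamean_mktuple2 {R : realType} (J : set R) (f : R -> R) (x : 'I_2 -> R) :
  qamean J f [tuple x i | i < 2] = qamean J f [tuple x ord0; x ord_max].
Proof.
congr qamean; apply/eq_from_tnth => i; rewrite tnth_mktuple.
by case: i => -[|[|//]] p; rewrite /tnth /=; congr x; apply/val_inj.
Qed.

(* The hypothesis [hk1] is void for k >= 2.  For k = 1 it cannot be dropped:
   if f_0 = f_1 is discontinuous then (a), (b), (c) hold with equality while
   (d) fails. *)
Theorem corollary3p4 (R : realType) (k : nat) (f : 'I_k.+1 -> R -> R)
    (hk : (1 <= k)%N)
    (hf : forall j, strictly_increasing (Rpos R) (f j))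
    (hk1 : k = 1%N -> exists j, {within Rpos R, continuous (f j)}) :
  [<->
    (* (a) *)
    forall (n : nat) (x : 'I_n -> 'I_k -> R),
      (1 <= n)%N -> (forall i j, Rpos R (x i j)) ->
      qamean (Rpos R) (f ord0) [tuple \prod_(j < k) x i j | i < n]
      <= \prod_(j < k) qamean (Rpos R) (f (lift ord0 j)) [tuple x i j | i < n];
    (* (b) *)
    forall (n : nat) (x : 'I_n -> 'I_k -> R) (l : 'I_n -> R),
      (1 <= n)%N -> (forall i j, Rpos R (x i j)) -> weights R n l ->
      wqamean (Rpos R) (f ord0) [tuple \prod_(j < k) x i j | i < n] l
      <= \prod_(j < k) wqamean (Rpos R) (f (lift ord0 j)) [tuple x i j | i < n] l;
    (* (c) *)
    forall x y : 'I_k -> R,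
      (forall j, Rpos R (x j)) -> (forall j, Rpos R (y j)) ->
      qamean (Rpos R) (f ord0) [tuple \prod_(j < k) x j; \prod_(j < k) y j]
      <= \prod_(j < k) qamean (Rpos R) (f (lift ord0 j)) [tuple x j; y j];
    (* (d) *)
    (forall j, {within Rpos R, continuous (f j)}) /\
    concave_function (Psi_dom (Rpos R) f) (Psi (Rpos R) f)].
Proof.
pose two_points (x y : 'I_k -> R) (i : 'I_2) := if i == ord0 then x else y.
have two_point : (forall (n : nat) (x : 'I_n -> 'I_k -> R),
      (1 <= n)%N -> (forall i j, Rpos R (x i j)) ->
      qamean (Rpos R) (f ord0) [tuple \prod_(j < k) x i j | i < n]
      <= \prod_(j < k) qamean (Rpos R) (f (lift ord0 j)) [tuple x i j | i < n]) ->
    two_point_inequality f.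
  move=> a x y xJ yJ; have := a 2%N (two_points x y) isT.
  rewrite qamean_mktuple2; under [leRHS]eq_bigr => j _.
    rewrite (qamean_mktuple2 _ _ (fun i => two_points x y i j)); over.
  by apply=> i j; rewrite /two_points; case: ifP.
have equal_weights n (x : 'I_n -> 'I_k -> R) : (1 <= n)%N ->
    (forall l, weights R n l ->
      wqamean (Rpos R) (f ord0) [tuple \prod_(j < k) x i j | i < n] l <=
      \prod_(j < k) wqamean (Rpos R) (f (lift ord0 j)) [tuple x i j | i < n] l) ->
    qamean (Rpos R) (f ord0) [tuple \prod_(j < k) x i j | i < n] <=
    \prod_(j < k) qamean (Rpos R) (f (lift ord0 j)) [tuple x i j | i < n].
  move=> n_gt0 b; rewrite qamean_wqamean.
  under eq_bigr do rewrite qamean_wqamean.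
  apply: b; split=> [i|]; first exact: ler01.
  by exists (Ordinal n_gt0); exact: oner_neq0.
have cont c := two_point_continuous f hf hk c hk1.
tfae.
- move=> /two_point c n x l _ xJ; have cf := cont c.
  by apply: concave_wqamean_le => //; exact: two_point_concave.
- move=> b; apply: two_point => n x n_gt0 xJ.
  by apply: equal_weights => // l; exact: b.
- by move=> c; have cf := cont c; split=> //; exact: two_point_concave.
- move=> [cf conc] n x n_gt0 xJ; apply: equal_weights => // l.
  exact: concave_wqamean_le.
Qed.
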